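(* For every simple connected graph $G$, we have $\min\mathrm{ovl}(G)\le 2$.
   Context: All graphs are finite and undirected; a simple graph has no loops and no parallel edges. An odd $3$-edge-covering of $G$ is a map $\psi:E(G)\to 2^{\{1,2,3\}}\setminus\{\emptyset\}$ (each edge receives one or more colors) such that for each color $c$ the set $E_c=\{e\in E(G): c\in\psi(e)\}$ forms an odd graph: for every vertex $v$, the number of edges of $E_c$ incident with $v$ is either $0$ or odd. The overlap of $\psi$ is $\mathrm{ovl}(\psi)=\sum_{e\in E(G),\,|\psi(e)|\ge 2}|\psi(e)|$, i.e. the sum, over all edges receiving more than one color, of the number of colors received. Finally $\min\mathrm{ovl}(G)=\min_{\psi}\mathrm{ovl}(\psi)$, where the minimum is over all odd $3$-edge-coverings $\psi$ of $G$. It is a known theorem (Mátrai) that every connected simple graph has an odd $3$-edge-covering, so this minimum is well defined. The value $\mathrm{ovl}(\psi)=0$ means every edge receives exactly one color, and $\mathrm{ovl}(\psi)=2$ means exactly one edge receives two colors and all others receive one. *)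

(* Defs.v *)
From mathcomp Require Import all_boot.

Set Implicit Arguments.
Unset Strict Implicit.
Unset Printing Implicit Defensive.

(* A simple graph on the finite vertex type T is a symmetric irreflexive
   relation e : rel T; its edges are the two-element sets [set x; y] with
   e x y. *)
Section OddCoverings.

Variables (T : finType) (e : rel T).

Definition edges : {set {set T}} :=
  [set A | [exists x, exists y, e x y && (A == [set x; y])]].

Definition connected : Prop := forall x y : T, connect e x y.

Definition degree (F : {set {set T}}) (v : T) : nat :=
  #|[set A in F | v \in A]|.

Definition odd_graph (F : {set {set T}}) : bool :=
  [forall v : T, (degree F v == 0) || odd (degree F v)].

(* A coloring is total on {set T}, but only its values on edges are ever
   used; the three colors are the elements of 'I_3. *)
Definition coloring : finType := {ffun {set T} -> {set 'I_3}}.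

Definition color_class (psi : coloring) (c : 'I_3) : {set {set T}} :=
  [set A in edges | c \in psi A].

Definition odd_3_edge_covering (psi : coloring) : bool :=
  [forall A in edges, psi A != set0]
  && [forall c : 'I_3, odd_graph (color_class psi c)].

Definition ovl (psi : coloring) : nat :=
  \sum_(A in edges | 2 <= #|psi A|) #|psi A|.

(* The default value 3 * #|edges| bounds every overlap from above, so it
   does not affect the minimum when a covering exists (minovl_attained); and
   it does not make a bound minovl <= 2 hold when there is no covering
   (minovl_le2). *)
Definition minovl : nat :=
  \big[minn/3 * #|edges|]_(psi : coloring | odd_3_edge_covering psi) ovl psi.

Lemma ovl_le (psi : coloring) : ovl psi <= 3 * #|edges|.
Proof.
rewrite mulnC -sum_nat_const /ovl big_mkcondr; apply: leq_sum => A _.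
by case: ifP => // _; rewrite -[X in _ <= X]card_ord max_card.
Qed.

Lemma minovl_lower (psi : coloring) :
  odd_3_edge_covering psi -> minovl <= ovl psi.
Proof.
move=> cov; rewrite /minovl; have := mem_index_enum psi.
elim: (index_enum _) => [|phi s IH] //; rewrite inE big_cons.
case/predU1P=> [<- | /IH le_s]; first by rewrite cov geq_minl.
by case: ifP => // _; apply: leq_trans (geq_minr _ _) le_s.
Qed.

Lemma minovl_cases :
  minovl = 3 * #|edges| \/
  exists2 psi, odd_3_edge_covering psi & ovl psi = minovl.
Proof.
rewrite /minovl; elim/big_rec: _ => [|psi m cov IH]; first by left.
case: (leqP (ovl psi) m) => _; first by right; exists psi.
exact: IH.
Qed.

Lemma minovl_attained (psi0 : coloring) :
  odd_3_edge_covering psi0 ->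
  exists2 psi, odd_3_edge_covering psi & ovl psi = minovl.
Proof.
move=> cov; case: minovl_cases => // eq_min; exists psi0 => //.
by apply/eqP; rewrite eqn_leq minovl_lower // eq_min ovl_le.
Qed.

Lemma minovl_le2 :
  minovl <= 2 <-> exists2 psi, odd_3_edge_covering psi & ovl psi <= 2.
Proof.
split=> [le2 | [psi cov]]; last exact: leq_trans (minovl_lower cov).
case: minovl_cases => [eq_min | [psi cov eq_ovl]]; last first.
  by exists psi; rewrite ?eq_ovl.
move: le2; rewrite eq_min; case E: #|edges| => [|n]; last by rewrite mulnS.
move: E => /eqP; rewrite cards_eq0 => /eqP E _.
exists [ffun => set0].
  rewrite /odd_3_edge_covering; apply/andP; split.
    by apply/forall_inP=> A; rewrite E inE.
  apply/forallP=> c; apply/forallP=> v; apply/orP; left.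
  by rewrite /degree /color_class E cards_eq0; apply/eqP/setP=> A; rewrite !inE.
by rewrite /ovl E big_pred0 // => A; rewrite inE.
Qed.

End OddCoverings.

(* Main.v *)
Require Import Defs.
From mathcomp Require Import all_boot all_algebra zify.

Set Implicit Arguments.
Unset Strict Implicit.
Unset Printing Implicit Defensive.

(** The color classes are found by linear algebra over the field with two
    elements. Call a graph acyclic when its only subgraph with all degrees even
    is the empty one, and let J be a T-join: a subgraph whose odd-degree
    vertices are those of T. Two consequences of one duality principle
    ([parity_duality]) carry the proof. A T-join exists unless T meets some
    union of components in an odd number of vertices ([separated_join]), and a
    T-join with the fewest edges left outside has an acyclic complement
    ([join_forest_complement]). A graph splits into two odd graphs unless it
    has an obstruction, a certain nonempty subgraph with all degrees even
    ([two_coloring]); so an acyclic graph always splits.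

    If G has even order, take J with all degrees odd and split its acyclic
    complement: three classes without overlap ([minovl_even_order]).

    If G has odd order, it has an odd number of vertices of even degree,
    and one of them, v, is such that each component of G - v contains an even
    number of the others ([balanced_even_vertex]). By the handshake lemma, each
    component of G - v then has as many vertices, modulo 2, as neighbours of v.

    Suppose that a component X of G - v has odd order. There is a join J of
    G - v that becomes odd at all vertices but v when all edges at v are added
    to it. The rest of G - v can be taken acyclic and splits into Y and Z.
    Coloring this large class 1 on the side of X and 2 on the other side, Y the
    other way round, and Z with 3 gives v an odd number of edges of color 1 and
    an odd number of edges of color 2, without overlap
    ([minovl_odd_separation]).

    Otherwise all components of G - v have even order. Let J be a join of G - v,
    odd at all vertices but v, with acyclic complement F in G - v, and let
    K be F with all edges at v. If K splits, this is a decomposition. If not,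
    the obstruction P in K is unique. Doubling an edge A of J, that is,
    splitting K with A added while A keeps color 1, destroys P unless both ends
    of A avoid P or both lie on P and have even degree in K
    ([minovl_le2_or_obstruction]). With F minimal, this can fail for all A only
    if all vertices but v have odd degree ([minovl_le2_or_others_odd]). In that
    case, if F can be chosen to avoid some vertex x that is not adjacent to v,
    an edge of J leaving P is there to be doubled ([minovl_spared_vertex]). If
    no F avoids any such x, then some vertex u adjacent to v has its
    neighbours, but for v and at most one more, among the neighbours of v: the
    set of vertices cut off by v and a further vertex can be shrunk until it
    contains only neighbours of v. For such a u the classes can be written
    down: the star of u, the edge uv with a graph that meets each neighbour of
    u other than v once, and the rest ([minovl_two_stars], [minovl_cut_pair]). *)

(** * Linear systems over the field with two elements *)

Section Duality.
Import GRing.Theory.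
Local Open Scope ring_scope.

Lemma F2_nat_eq0 n : (n%:R == 0 :> 'F_2) = ~~ odd n.
Proof. by rewrite -(dvdn_pcharf (pchar_Fp (isT : prime 2))) dvdn2. Qed.

Lemma F2_sum_support (I : finType) (f : I -> 'F_2) (p : pred I) :
  (\sum_i f i * (p i)%:R != 0) = odd #|[set i | (f i != 0) && p i]|.
Proof.
have f01 (x : 'F_2) : x = (x != 0)%:R by case: x => [[|[|]]] //= i; apply/val_inj.
rewrite -[RHS]negbK -F2_nat_eq0 -sum1_card natr_sum [in RHS]big_mkcond /=.
congr (_ != 0); apply: eq_bigr => i _.
by rewrite {1}[f i]f01 -natrM mulnb inE; case: (_ && _).
Qed.

(** The Fredholm alternative: if a parity system has no solution, then some of
    its equations add up to 0 = 1. *)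
Lemma parity_duality (I E : finType) (a : I -> E -> bool) (b : pred I) :
  (exists X : {set E}, forall i, odd #|[set x in X | a i x]| = b i) \/
  (exists2 Y : {set I}, forall x, ~~ odd #|[set i in Y | a i x]|
     & odd #|[set i in Y | b i]|).
Proof.
pose M : 'M['F_2]_(#|E|, #|I|) :=
  \matrix_(j, i) (a (enum_val i) (enum_val j))%:R.
pose r : 'rV['F_2]_#|I| := \row_i (b (enum_val i))%:R.
have rank_bij (U : finType) : {on [pred _ | true], bijective (@enum_rank U)}.
  by exists enum_val => x _; rewrite ?enum_rankK ?enum_valK.
have [/submxP[u def_r] | not_rM] := boolP (r <= M)%MS.
  left; exists [set x | u 0 (enum_rank x) != 0] => i.
  have := congr1 (fun s : 'rV_ _ => s 0 (enum_rank i)) def_r.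
  rewrite !mxE enum_rankK (reindex _ (rank_bij _)) /= => def_b.
  have -> : b i = (((b i)%:R : 'F_2) != 0) by case: (b i).
  rewrite def_b; under eq_bigr => j _ do rewrite mxE !enum_rankK.
  by rewrite F2_sum_support; congr (odd _); apply: eq_card => x; rewrite !inE.
(* A column of the cokernel on which r does not vanish combines the
   equations into a contradiction. *)
right; move: not_rM; rewrite submxE => /matrix0Pn[i0 [k]].
rewrite [i0]ord1 => {i0} rk_neq0; pose y i := cokermx M (enum_rank i) k.
have sum_y (s : 'rV_#|I|) :
    (s *m cokermx M) 0 k = \sum_i y i * s 0 (enum_rank i).
  rewrite mxE (reindex _ (rank_bij _)) /=.
  by apply: eq_bigr => i _; rewrite mulrC.
have count_y (p : pred I) :
    odd #|[set i in [set i | y i != 0] | p i]| = (\sum_i y i * (p i)%:R != 0).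
  by rewrite F2_sum_support; congr (odd _); apply: eq_card => i; rewrite !inE.
exists [set i | y i != 0] => [x|]; rewrite count_y.
  have := sum_y (row (enum_rank x) M).
  rewrite -row_mul mulmx_coker row0 mxE; under eq_bigr => i _ do rewrite !mxE !enum_rankK.
  by move=> <-; rewrite eqxx.
move: rk_neq0; rewrite sum_y.
by under eq_bigr => i _ do rewrite !mxE enum_rankK.
Qed.
End Duality.

(** * Parities of degrees, joins and splittings into two odd graphs *)
Section Parity.
Variable T : finType.
Implicit Types (F G H J K Z : {set {set T}}) (A B : {set T}) (v w x y : T).

Definition symdiff (S : finType) (X Y : {set S}) : {set S} :=
  [set s | (s \in X) (+) (s \in Y)].

Lemma card_symdiff (S : finType) (X Y : {set S}) :
  #|symdiff X Y| + #|X :&: Y|.*2 = #|X| + #|Y|.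
Proof.
have -> : symdiff X Y = (X :\: Y) :|: (Y :\: X).
  by apply/setP=> s; rewrite !inE; case: (s \in X); case: (s \in Y).
rewrite cardsU; have -> : (X :\: Y) :&: (Y :\: X) = set0.
  by apply/setP=> s; rewrite !inE; case: (s \in X); case: (s \in Y).
by rewrite cards0 subn0 -[#|X|](cardsID Y) -[#|Y|](cardsID X) [Y :&: X]setIC -addnn; lia.
Qed.

Lemma odd_card_symdiff (S : finType) (X Y : {set S}) :
  odd #|symdiff X Y| = odd #|X| (+) odd #|Y|.
Proof. by rewrite -oddD -card_symdiff oddD odd_double addbF. Qed.

Lemma odd_degree_symdiff F G w :
  odd (degree (symdiff F G) w) = odd (degree F w) (+) odd (degree G w).
Proof.
rewrite -odd_card_symdiff /degree; congr (odd _); apply: eq_card => A.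
by rewrite !inE; case: (w \in A); rewrite ?andbT ?andbF.
Qed.

Lemma degreeID F G w : degree F w = degree (F :&: G) w + degree (F :\: G) w.
Proof.
rewrite /degree -(cardsID G [set A in F | w \in A]).
by congr (_ + _); apply: eq_card => A; rewrite !inE; do ![case: (_ \in _)].
Qed.

Lemma degreeD F G w : G \subset F -> degree F w = degree G w + degree (F :\: G) w.
Proof. by move=> sGF; rewrite (degreeID F G) (setIidPr sGF). Qed.

Lemma degreeU1 F A w : A \notin F -> degree (A |: F) w = (w \in A) + degree F w.
Proof.
move=> AF; rewrite (@degreeD _ [set A]) ?subsetUl //; congr (_ + _); last first.
  congr (degree _ w); apply/setP=> B; rewrite !inE; case: eqP => //= ->.
  by rewrite (negPf AF).
rewrite /degree; case wA: (w \in A).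
  rewrite -[RHS](cards1 A); apply: eq_card => B; rewrite !inE.
  by case: eqP => // ->.
by apply: eq_card0 => B; rewrite !inE; case: eqP => // ->.
Qed.

Lemma degree_gt0P F w : reflect (exists2 A, A \in F & w \in A) (0 < degree F w).
Proof.
apply: (iffP card_gt0P) => [[A] | [A FA wA]]; last by exists A; rewrite inE FA.
by rewrite inE => /andP[]; exists A.
Qed.

Lemma degree_sub F G w : F \subset G -> degree F w <= degree G w.
Proof.
move=> /subsetP sFG; apply/subset_leq_card/subsetP=> A; rewrite !inE.
by case/andP=> /sFG-> .
Qed.

Lemma degree_eq_mem F G A w :
  F \subset G -> degree F w = degree G w -> A \in G -> w \in A -> A \in F.
Proof.
move=> /subsetP sFG eq_deg GA wA.
have sub : [set B in F | w \in B] \subset [set B in G | w \in B].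
  by apply/subsetP=> B; rewrite !inE => /andP[/sFG-> ->].
have /setP/(_ A) : [set B in F | w \in B] = [set B in G | w \in B].
  by apply/eqP; rewrite eqEcard sub /= -/(degree G w) -eq_deg /degree.
by rewrite !inE GA wA !andbT => ->.
Qed.

Definition even_graph F := forall w, ~~ odd (degree F w).

(** The binary cycle space of F is trivial, that is, F is a forest; a join of
    least size has this property at once, without any discussion of paths. *)
Definition acyclic F := forall Z, Z \subset F -> even_graph Z -> Z = set0.

Definition simple F := forall A, A \in F -> #|A| = 2.

(** A degree that is even and positive is at least 2. *)
Lemma even_graph_next Z A w :
  even_graph Z -> A \in Z -> w \in A -> exists B, [/\ B \in Z, w \in B & B != A].
Proof.
move=> evZ ZA wA.
have odd_rest : odd (degree (Z :\ A) w).
  by have := evZ w; rewrite -{1}(setD1K ZA) degreeU1 ?inE ?eqxx // wA negbK.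
have [B] := degree_gt0P _ _ (odd_gt0 odd_rest).
by rewrite !inE => /andP[neqBA ZB] wB; exists B.
Qed.

(** The ends of an edge of Z have further edges of Z, and these differ because
    there are no parallel edges: a cycle has length at least 3. *)
Lemma even_graph_card Z : simple Z -> even_graph Z -> Z != set0 -> 2 < #|Z|.
Proof.
move=> sZ evZ /set0Pn[A ZA].
have /eqP/cards2P[x [y [neq_xy defA]]] := sZ A ZA.
have [B [ZB xB neqBA]] : exists B, [/\ B \in Z, x \in B & B != A].
  by apply: even_graph_next; rewrite // defA !inE eqxx.
have [C [ZC yC neqCA]] : exists B, [/\ B \in Z, y \in B & B != A].
  by apply: even_graph_next; rewrite // defA !inE eqxx orbT.
have neqBC : B != C.
  apply: contraNneq neqBA => eqBC; rewrite eq_sym eqEcard !sZ // leqnn andbT.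
  by rewrite defA subUset !sub1set xB eqBC yC.
have sub : [set A; B; C] \subset Z by rewrite !subUset !sub1set ZA ZB ZC.
apply: leq_trans (subset_leq_card sub); rewrite setUC cardsU1 !inE negb_or.
by rewrite neqCA [C == B]eq_sym neqBC cards2 eq_sym neqBA.
Qed.

(** A contradictory combination of the equations of a U-join is a set D of
    vertices that no edge of H leaves and that has an odd part in U. *)
Lemma join_exists H (U : {set T}) :
    (forall D, (forall A, A \in H -> ~~ odd #|A :&: D|) -> ~~ odd #|D :&: U|) ->
  exists2 F : {set {set T}}, F \subset H & forall w, odd (degree F w) = (w \in U).
Proof.
move=> evU.
have [[X defX] | [D evD oddD]] :=
  parity_duality (fun w A => (A \in H) && (w \in A)) (mem U); last first.
  have /negP[] : ~~ odd #|D :&: U|.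
    apply: evU => A HA; move: (evD A); congr (~~ odd _).
    by apply: eq_card => w; rewrite !inE HA andbC.
  by move: oddD; congr (odd _); apply: eq_card => w; rewrite !inE.
exists (X :&: H) => [|w]; first exact: subsetIr.
rewrite -[RHS]defX; congr (odd _); apply: eq_card => A; rewrite !inE.
by rewrite andbA.
Qed.

(** Minimality gives more than acyclicity: exchanging F along a cycle of length
    at least 3 with all edges but one in F would make F smaller, so even one
    added edge leaves F acyclic. *)
Lemma minimal_join H F0 : simple H -> F0 \subset H ->
  exists F, [/\ F \subset H, forall w, odd (degree F w) = odd (degree F0 w),
    acyclic F & forall A, A \in H -> A \notin F -> acyclic (A |: F)].
Proof.
move=> sH sF0H.
pose P F := (F \subset H) && [forall w, odd (degree F w) == odd (degree F0 w)].
have P0 : P F0 by rewrite /P sF0H; apply/forallP.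
case: (arg_minnP (fun F => #|F|) P0) => F /andP[sFH /forallP parF] minF.
have cardZ Z : Z \subset H -> even_graph Z -> #|F :&: Z|.*2 <= #|Z|.
  move=> sZH evZ; rewrite -(leq_add2l #|symdiff F Z|) card_symdiff leq_add2r.
  apply: minF; apply/andP; split.
    apply/subsetP=> A; rewrite inE; case FA: (A \in F) => /= ZA.
      exact: (subsetP sFH).
    exact: (subsetP sZH).
  apply/forallP=> w; rewrite odd_degree_symdiff (eqP (parF w)).
  by rewrite (negPf (evZ w)) addbF.
exists F; split=> // [w|Z sZF evZ|A HA FA Z sZAF evZ]; first exact/eqP.
  have := cardZ Z (subset_trans sZF sFH) evZ; rewrite (setIidPr sZF) => le_Z.
  by apply/eqP; rewrite -cards_eq0; lia.
have sAFH : A |: F \subset H by rewrite subUset sub1set HA.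
have sZH := subset_trans sZAF sAFH.
apply: contraTeq (cardZ Z sZH evZ) => nzZ; rewrite -ltnNge.
have Z3 : 2 < #|Z| by apply: even_graph_card => // B /(subsetP sZH)/sH.
have : Z :\ A \subset F :&: Z.
  apply/subsetP=> B; rewrite !inE => /andP[neqBA ZB]; rewrite ZB andbT.
  by have := subsetP sZAF B ZB; rewrite !inE (negPf neqBA).
move=> /subset_leq_card; move: Z3; rewrite (cardsD1 A Z).
by case: (A \in Z) => /=; move: #|_ :\ _| #|_ :&: _| => m n; lia.
Qed.

(** The dual certificate for a splitting of K into two odd graphs. At a vertex
    of positive even degree in K one color must have odd degree; at a vertex of
    odd degree all edges must have the same color. A contradictory combination
    of these equations uses all or no edges at a vertex of the first kind, an
    even number of them at one of the second kind, and an odd number of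
    vertices of the first kind. *)
Definition alternating_obstruction K Z :=
  [/\ Z \subset K, even_graph Z,
      forall w, ~~ odd (degree K w) -> 0 < degree Z w -> degree Z w = degree K w
    & odd #|[set w | ~~ odd (degree K w) && (0 < degree Z w)]|].

(** The system has one unknown for the color of each edge and one for the color
    common to the edges at each vertex of odd degree. *)
Lemma two_coloring K : simple K ->
  (exists X : {set {set T}}, [/\ X \subset K, odd_graph X & odd_graph (K :\: X)]) \/
  (exists Z, alternating_obstruction K Z).
Proof.
move=> sK.
(* The equation (w, A) equates the color of A with that of w if w has odd
   degree; for w of even degree, (w, set0) is the equation of w, and the others
   are void.  As edges are nonempty, set0 is not one of them. *)
pose a (i : T * {set T}) (x : {set T} + T) := let: (w, A) := i in
  if odd (degree K w) then
    [&& A \in K, w \in A & (x == inl A) || (x == inr w)]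
  else (A == set0) && (if x is inl B then (B \in K) && (w \in B) else false).
pose b (i : T * {set T}) := let: (w, A) := i in
  [&& ~~ odd (degree K w), A == set0 & 0 < degree K w].
have [[X defX] | [Y evY oddY]] := parity_duality a b; [left | right].
  pose XK := [set A in K | inl A \in X]; have sXK : XK \subset K.
    by apply/subsetP=> A; rewrite inE => /andP[].
  exists XK; suff odd_w w :
      ((degree XK w == 0) || odd (degree XK w)) &&
      ((degree (K :\: XK) w == 0) || odd (degree (K :\: XK) w)).
    by split=> //; apply/forallP=> w; case/andP: (odd_w w).
  have degK := degreeD w sXK; case oddK: (odd (degree K w)); last first.
    have := defX (w, set0).
    have -> : #|[set x in X | a (w, set0) x]| = degree XK w.
      rewrite /degree -(card_imset _ (@inl_inj {set T} T)).
      apply: eq_card => x; rewrite inE; apply/andP/imsetP => /=.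
        rewrite oddK eqxx; case: x => [A|w'] [XA] //= /andP[KA wA].
        by exists A; rewrite // !inE KA XA.
      by case=> A; rewrite !inE -andbA => /and3P[KA XA wA] ->; rewrite oddK eqxx KA wA.
    rewrite /= oddK eqxx /=.
    move: oddK; rewrite degK oddD; case: (posnP (_ + _)).
      by move/eqP; rewrite addn_eq0 => /andP[-> ->].
    by move=> _ + odd_XK; rewrite odd_XK addTb => /negbFE ->; rewrite !orbT.
  have eq_col A : A \in K -> w \in A -> (A \in XK) = (inr w \in X).
    move=> KA wA; have := defX (w, A).
    have -> : [set x in X | a (w, A) x] = X :&: [set inl A; inr w].
      by apply/setP=> x; rewrite !inE /= oddK KA wA.
    rewrite /= oddK [A \in XK]inE KA /= setIC setIUl.
    rewrite cardsU; have -> : [set inl A] :&: X :&: ([set inr w] :&: X) = set0.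
      apply/setP=> x; rewrite !inE; case: eqP => // ->.
      by rewrite andbF.
    rewrite cards0 subn0 oddD.
    have odd1 (x : {set T} + T) : odd #|[set x] :&: X| = (x \in X).
      case Xx: (x \in X); first by rewrite (setIidPl _) ?sub1set // cards1.
      by rewrite (_ : _ :&: _ = set0) ?cards0 //; apply/setP=> t; rewrite !inE; case: eqP => // ->.
    by rewrite !odd1; case: (_ \in X); case: (_ \in X).
  case Xw: (inr w \in X).
    have -> : degree (K :\: XK) w = 0.
      apply/eqP; rewrite -leqn0 leqNgt; apply/degree_gt0P=> -[A].
      by rewrite in_setD => /andP[nA KA] wA; rewrite eq_col // Xw in nA.
    have -> : degree XK w = degree K w.
      apply: eq_card => A; rewrite inE [in RHS]inE; case wA: (w \in A); rewrite ?andbF // !andbT.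
      by apply/idP/idP=> [/(subsetP sXK) // | KA]; rewrite eq_col.
    by rewrite oddK orbT.
  have XK0 : degree XK w = 0.
    apply/eqP; rewrite -leqn0 leqNgt; apply/degree_gt0P=> -[A XA wA].
    by rewrite -(eq_col A) ?(subsetP sXK) ?XA in Xw.
  by rewrite XK0 eqxx; rewrite degK XK0 add0n in oddK; rewrite oddK orbT.
(* h w A tells whether the combination Y involves A through its end w.  The
   equation of the unknown A makes it hold for both ends of A or for none. *)
pose h w A := (w, if odd (degree K w) then A else set0) \in Y.
pose Z := [set A in K | [exists w in A, h w A]].
have evA A : A \in K -> ~~ odd #|[set w in A | h w A]|.
  move=> KA; have := evY (inl A); congr (~~ odd _).
  pose f w := (w, if odd (degree K w) then A else set0).
  rewrite -(card_imset _ (_ : injective f)); last first.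
    by move=> w w' [].
  apply: eq_card => -[w B]; rewrite inE; apply/andP/imsetP => /=.
    case=> YwB; case: ifP => oddK.
      case/and3P=> KB wB; rewrite orbF => /eqP[eqAB].
      by exists w; rewrite /f /h ?inE oddK eqAB ?wB.
    case/andP=> /eqP eqB /andP[_ wA]; exists w; last by rewrite /f oddK eqB.
    by rewrite inE wA /h oddK -eqB.
  case=> w'; rewrite inE /f => /andP[wA hw] [-> ->]; split=> //.
  by case: ifP => oddK; rewrite ?oddK ?KA ?wA ?eqxx.
have memZ A w : A \in K -> w \in A -> (A \in Z) = h w A.
  move=> KA wA; rewrite inE KA /=; apply/existsP/idP=> [[w' /andP[w'A hw']] | hw].
    apply: contraR (evA A KA) => nhw.
    have /eqP/cards2P[p [q [neq_pq defA]]] := sK A KA.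
    suff -> : [set w in A | h w A] = [set w'] by rewrite cards1.
    apply/setP=> t; rewrite !inE; apply/andP/eqP=> [[tA ht] | -> //].
    have nwt : t != w by apply: contraNneq nhw => <-.
    have nww : w' != w by apply: contraNneq nhw => <-.
    move: tA w'A wA nwt nww; rewrite defA !inE.
    by do 3!case/orP=> /eqP->; rewrite ?eqxx.
  by exists w; rewrite wA.
have sZK : Z \subset K by apply/subsetP=> A; rewrite inE => /andP[].
have degZ_even w : ~~ odd (degree K w) ->
    degree Z w = if (w, set0) \in Y then degree K w else 0.
  move=> evK; case: ifP => hw.
    apply: eq_card => A; rewrite inE [in RHS]inE; case wA: (w \in A); rewrite ?andbF // !andbT.
    by case KA: (A \in K); [rewrite (memZ A w) // /h (negPf evK) | rewrite inE KA].
  apply/eqP; rewrite -leqn0 leqNgt; apply/degree_gt0P=> -[A ZA wA].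
  by move: ZA (ZA); rewrite {1}inE => /andP[KA _]; rewrite (memZ A w) // /h (negPf evK) hw.
exists Z; split=> // [w | w evK | ].
- have [oddK | evK] := boolP (odd (degree K w)); last first.
    by rewrite degZ_even //; case: ifP.
  have := evY (inr w); congr (~~ odd _).
  rewrite /degree -[RHS](card_imset _ (_ : injective (pair w))); last first.
    by move=> A A' [].
  apply: eq_card => -[w' A]; rewrite inE; apply/andP/imsetP => /=.
    case=> YwA; case: ifP => oddw'; last by rewrite andbF.
    case/and3P=> KA w'A /eqP[eqw]; rewrite -eqw in w'A oddw' YwA *.
    by exists A; rewrite // inE w'A andbT (memZ A w) // /h oddK.
  case=> B; rewrite inE => /andP[ZB wB] [-> ->]; rewrite oddK wB eqxx.
  have KB := subsetP sZK _ ZB; rewrite KB; split=> //.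
  by move: ZB; rewrite (memZ B w) // /h oddK.
- by rewrite degZ_even //; case: ifP.
move: oddY; congr (odd _).
rewrite -[RHS](card_imset _ (_ : injective (fun w => (w, set0 : {set T})))); last first.
  by move=> w w' [].
apply: eq_card => -[w A]; rewrite inE; apply/andP/imsetP => /=.
  case=> YwA /and3P[evK /eqP eqA Kw]; exists w; last by rewrite eqA.
  by rewrite inE evK degZ_even // -eqA YwA.
case=> w'; rewrite inE => /andP[evK]; rewrite degZ_even //.
by case: ifP => // Yw Kw [-> ->]; rewrite evK eqxx.
Qed.

Lemma acyclic_two_coloring K : simple K -> acyclic K ->
  exists X : {set {set T}}, [/\ X \subset K, odd_graph X & odd_graph (K :\: X)].
Proof.
move=> sK acK; have [// | [Z [sZK evZ _]]] := two_coloring sK.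
rewrite (acK Z) // (_ : [set w | _] = set0) ?cards0 //; apply/setP=> w.
rewrite !inE; apply/andP=> -[_ /degree_gt0P[A]].
by rewrite inE.
Qed.

End Parity.

(** * Edges, separations and joins in a graph *)
Section Graph.
Variables (T : finType) (e : rel T).
Hypotheses (e_sym : symmetric e) (e_irr : irreflexive e).
Implicit Types (A B : {set T}) (C D S U W X : {set T}) (F G J K M N P : {set {set T}}).
Implicit Types (u v w x y z h : T).

Local Notation E := (edges e).
Local Notation set_inE := (in_setU1, in_setU, in_setD1, in_setD, in_setI,
  in_setC1, in_setC, in_set2, in_set1, in_set0, in_setT).

Lemma edge_neq x y : e x y -> x != y.
Proof. by apply: contraTneq => ->; rewrite e_irr. Qed.

Lemma mem_edge x y : ([set x; y] \in E) = e x y.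
Proof.
rewrite inE; apply/existsP/idP => [[a /existsP[b /andP[ab /eqP eq_ab]]] | xy].
  have := set21 a b; have := set22 a b; rewrite -eq_ab !inE.
  by case/orP=> /eqP eb /orP[] /eqP ea; move: ab; rewrite ea eb ?e_irr // e_sym.
by exists x; apply/existsP; exists y; rewrite xy /=.
Qed.

Lemma edgeP A w : A \in E -> w \in A -> exists2 u, e w u & A = [set w; u].
Proof.
rewrite inE => /existsP[a /existsP[b /andP[ab /eqP->]]].
rewrite !inE => /orP[] /eqP->; first by exists b.
by exists a; rewrite ?(e_sym b) // setUC.
Qed.

Lemma edge_ex A : A \in E -> exists x y, e x y /\ A = [set x; y].
Proof.
by rewrite inE => /existsP[a /existsP[b /andP[ab /eqP->]]]; exists a, b.
Qed.

Lemma edges_simple : simple E.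
Proof. by move=> A /edge_ex[x [y [xy ->]]]; rewrite cards2 (edge_neq xy). Qed.

Lemma sub_simple F G : G \subset F -> simple F -> simple G.
Proof. by move=> /subsetP sGF sF A /sGF/sF. Qed.

(** The classes may share a single edge, and only two of them may. *)
Lemma minovl_le2_classes (E1 E2 E3 : {set {set T}}) A0 :
    E1 \subset E -> E2 \subset E -> E3 \subset E ->
    odd_graph E1 -> odd_graph E2 -> odd_graph E3 ->
    (forall A, A \in E ->
       0 < (A \in E1) + (A \in E2) + (A \in E3) <= 1 + (A == A0)) ->
  minovl e <= 2.
Proof.
move=> sE1 sE2 sE3 odd1 odd2 odd3 cover; apply/minovl_le2.
pose cl (c : 'I_3) := nth set0 [:: E1; E2; E3] c.
pose psi : coloring T := [ffun A => [set c | A \in cl c]].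
have card_psi A : #|psi A| = (A \in E1) + (A \in E2) + (A \in E3).
  rewrite ffunE -sum1_card big_mkcond !big_ord_recl big_ord0 !inE /cl /=.
  by do !case: (_ \in _).
have class_psi c : color_class e psi c = cl c.
  apply/setP=> A; rewrite in_set ffunE [X in _ && X]in_set; apply: andb_idl.
  case: c => [[|[|[|//]]] ?]; rewrite /cl /=; exact: subsetP.
exists psi.
  apply/andP; split; first apply/forall_inP=> A EA.
    by rewrite -card_gt0 card_psi; case/andP: (cover A EA).
  by apply/forallP=> c; rewrite class_psi; case: c => [[|[|[|]]]].
rewrite /ovl big_mkcondr big_mkcond /=.
apply: (@leq_trans (\sum_A (if A == A0 then 2 else 0))); last first.
  by rewrite -big_mkcond big_pred1_eq.
apply: leq_sum => A _; case: ifP => // EA; case: ifP => // psi2.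
have := cover A EA; rewrite -card_psi => /andP[_ le_psi].
by case: eqP le_psi psi2 => _ /= le1 le2 //; have := leq_trans le2 le1.
Qed.

Definition avoid S := [set A in E | [disjoint A & S]].

Definition nbrs v := [set w | e v w].

Definition evens := [set w | ~~ odd (degree E w)].

(** D is a union of components of G - S. *)
Definition separated S D :=
  [disjoint D & S] &&
  [forall x, forall y, e x y ==> (x \in D) ==> (y \in S :|: D)].

Lemma separatedP S D :
  reflect ((forall x, x \in D -> x \notin S) /\
           (forall x y, e x y -> x \in D -> y \notin S -> y \in D))
          (separated S D).
Proof.
apply: (iffP andP) => [[dis /forallP cl] | [dis cl]]; split.
- by move=> x xD; rewrite (disjointFr dis xD).
- move=> x y xy xD yS; have /forallP/(_ y) := cl x.
  by rewrite xy xD inE (negPf yS).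
- rewrite disjoint_subset; apply/subsetP=> x /dis; by [].
- apply/forallP=> x; apply/forallP=> y; apply/implyP=> xy; apply/implyP=> xD.
  by rewrite inE; case yS: (y \in S) => //=; apply: cl xy xD _; rewrite yS.
Qed.

Lemma separated_compl S D : separated S D -> separated S (~: (S :|: D)).
Proof.
move=> /separatedP[dis cl]; apply/separatedP; split=> [x|x y xy].
  by rewrite !inE negb_or => /andP[].
rewrite !inE !negb_or => /andP[xS xD] yS; rewrite yS /=.
by apply: contra xD => yD; apply: cl yD xS; rewrite e_sym.
Qed.

Lemma mem_avoid S A : (A \in avoid S) = (A \in E) && [disjoint A & S].
Proof. by rewrite in_set. Qed.

Lemma avoid_sub S : avoid S \subset E.
Proof. by apply/subsetP=> A; rewrite mem_avoid => /andP[]. Qed.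

Lemma avoid_simple S : simple (avoid S).
Proof. exact: sub_simple (avoid_sub S) edges_simple. Qed.

Lemma mem_avoid1 A v : (A \in avoid [set v]) = (A \in E) && (v \notin A).
Proof. by rewrite mem_avoid disjoint_sym disjoints1. Qed.

Lemma degree_avoid S w : w \in S -> degree (avoid S) w = 0.
Proof.
move=> wS; apply/eqP; rewrite -leqn0 leqNgt; apply/degree_gt0P=> -[A].
by rewrite mem_avoid => /andP[_ dis] wA; rewrite (disjointFr dis wA) in wS.
Qed.

Lemma even_cut_separated S D :
    (forall A, A \in avoid S -> ~~ odd #|A :&: D|) ->
  separated S (D :\: S).
Proof.
move=> evD; apply/separatedP; split=> [x|x y xy]; rewrite !inE; first by case/andP.
case/andP=> xS xD yS; rewrite yS /=; have := evD [set x; y].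
rewrite mem_avoid mem_edge xy /= disjoints_subset subUset !sub1set !inE xS yS => /(_ isT).
apply: contraR => yD; rewrite (_ : _ :&: D = [set x]) ?cards1 //.
apply/setP=> z; rewrite !inE; case: (eqVneq z x) => [-> | _] //=.
by case: eqP => // ->; rewrite (negPf yD).
Qed.

(** The sets that no edge of G - S leaves are the unions of components of
    G - S, up to vertices of S, which U does not meet. *)
Lemma separated_join S U : [disjoint U & S] ->
    (forall D, separated S D -> ~~ odd #|D :&: U|) ->
  exists2 F : {set {set T}}, F \subset avoid S
    & forall w, odd (degree F w) = (w \in U).
Proof.
move=> dis evU; apply: join_exists => D evD.
have := evU _ (even_cut_separated evD); congr (~~ odd _); apply: eq_card => w.
by rewrite !inE; case wU: (w \in U); rewrite ?andbF // (disjointFr dis wU).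
Qed.

(** The complement of a join is itself a join, for other parities, so it can be
    chosen minimal. *)
Lemma join_forest_complement S U : [disjoint U & S] ->
    (forall D, separated S D -> ~~ odd #|D :&: U|) ->
  exists F : {set {set T}}, [/\ F \subset avoid S,
    forall w, odd (degree (avoid S :\: F) w) = (w \in U), acyclic F
    & forall A, A \in avoid S -> A \notin F -> acyclic (A |: F)].
Proof.
move=> dis evU; have [J sJ defJ] := separated_join dis evU.
have [F [sF parF acF acAF]] := minimal_join (@avoid_simple S) (subsetDl (avoid S) J).
exists F; split=> // w; rewrite -defJ.
have := congr1 odd (degreeD w sF); rewrite (degreeD w sJ) !oddD parF addbC.
by move/addbI.
Qed.

(** * Counting modulo 2 *)
Lemma odd_sum_card (S : finType) (Y : {set S}) (f : S -> nat) :
  odd (\sum_(s in Y) f s) = odd #|[set s in Y | odd (f s)]|.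
Proof.
rewrite -sum1_card.
rewrite [in RHS](eq_bigl (fun s => (s \in Y) && odd (f s))) => [|s]; last first.
  by rewrite in_set.
rewrite big_mkcondr !(big_morph odd oddD (erefl _)) /=.
by apply: eq_bigr => s _; case: (odd (f s)).
Qed.

Lemma sum_degree F D : \sum_(w in D) degree F w = \sum_(A in F) #|A :&: D|.
Proof.
have deg w : degree F w = \sum_(A in F) (w \in A).
  rewrite /degree -sum1_card big_mkcond [in RHS]big_mkcond; apply: eq_bigr => A _.
  by rewrite in_set; case: (A \in F); case: (w \in A).
under eq_bigr => w _ do rewrite deg.
rewrite exchange_big /=; apply: eq_bigr => A _; rewrite -sum1_card.
rewrite big_mkcond [in RHS]big_mkcond; apply: eq_bigr => w _.
by rewrite !set_inE; case: (w \in A); case: (w \in D).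
Qed.

Lemma even_sum (I : finType) (p : pred I) (f : I -> nat) :
  (forall i, p i -> ~~ odd (f i)) -> ~~ odd (\sum_(i | p i) f i).
Proof. by move=> evf; elim/big_ind: _ => // m n; rewrite oddD => /negPf-> /negPf->. Qed.

Lemma handshake F : simple F -> ~~ odd #|[set w | odd (degree F w)]|.
Proof.
move=> sF; have := sum_degree F [set: T] => /(congr1 odd).
rewrite odd_sum_card => eq_odd.
have -> : [set w | odd (degree F w)] = [set w in [set: T] | odd (degree F w)].
  by apply/setP=> w; rewrite !in_set.
rewrite eq_odd; apply: even_sum => A FA.
by rewrite setIT sF.
Qed.

Lemma degree_star u w :
  degree (E :\: avoid [set u]) w = if w == u then degree E u else e u w.
Proof.
case: eqP => [-> | /eqP neq_wu].
  rewrite (degreeD u (avoid_sub [set u])) degree_avoid ?set11 //.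
case uw: (e u w).
  rewrite -[RHS](cards1 [set u; w]); apply: eq_card => A; rewrite in_set.
  rewrite !set_inE mem_avoid1; case EA: (A \in E); last first.
    by rewrite andbF; apply/esym/eqP => defA; rewrite defA mem_edge uw in EA.
  rewrite andbT negbK; apply/andP/eqP=> [[uA wA] | ->]; last by rewrite set21 set22.
  have [x ux defA] := edgeP EA uA; move: wA.
  by rewrite defA !set_inE (negPf neq_wu) => /eqP->.
apply/eqP; rewrite -leqn0 leqNgt; apply/degree_gt0P=> -[A].
rewrite in_setD mem_avoid1 => /andP[uA EA] wA; rewrite EA negbK in uA.
have [x ux defA] := edgeP EA uA; move: wA.
by rewrite defA !set_inE (negPf neq_wu) => /eqP eq_wx; rewrite eq_wx ux in uw.
Qed.

Lemma degree_avoid1 u w : w != u ->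
  degree E w = e u w + degree (avoid [set u]) w.
Proof.
move=> neq_wu; rewrite (degreeD w (avoid_sub [set u])) degree_star.
by rewrite (negPf neq_wu) addnC.
Qed.

Lemma card_star u (p : pred {set T}) :
  #|[set A in E | (u \in A) && p A]| = #|[set w in nbrs u | p [set u; w]]|.
Proof.
have inj : {in [set w in nbrs u | p [set u; w]] &,
            injective (fun w => [set u; w])}.
  move=> x y; rewrite !in_set => /andP[ux _] /andP[uy _] eq_xy.
  have := set22 u x; rewrite eq_xy !set_inE eq_sym (negPf (edge_neq ux)).
  by move/eqP.
rewrite -(card_in_imset inj); apply: eq_card => A; rewrite in_set.
apply/and3P/imsetP=> [[EA uA pA] | [w]].
  have [w uw defA] := edgeP EA uA.
  by exists w; rewrite // !in_set uw -defA.
by rewrite in_set [w \in _]in_set => /andP[uw pw] ->; rewrite mem_edge uw set21.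
Qed.

Lemma degree_nbrs u : degree E u = #|nbrs u|.
Proof.
transitivity #|[set A in E | (u \in A) && predT A]|.
  by apply: eq_card => A; rewrite !in_set andbT.
by rewrite card_star; apply: eq_card => w; rewrite !in_set andbT.
Qed.

(** Summing the degrees over D counts each edge inside D twice and, besides
    these, the edges from h to D. *)
Lemma separated_parity h D : separated [set h] D ->
  odd #|D :&: evens| = odd #|D| (+) odd #|D :&: nbrs h|.
Proof.
move=> sepD; have [dis cl] := separatedP _ _ sepD.
have neq_h w : w \in D -> w != h by move/dis; rewrite !set_inE.
have : odd (\sum_(w in D) degree E w) = odd #|D :&: nbrs h|.
  rewrite (eq_bigr (fun w => e h w + degree (avoid [set h]) w)); last first.
    by move=> w /neq_h /degree_avoid1.
  rewrite big_split oddD sum_degree /= odd_sum_card.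
  rewrite (negPf (even_sum _)) ?addbF => [|A]; last first.
    rewrite mem_avoid1 => /andP[EA hA].
    have [x [y [xy defA]]] := edge_ex EA; move: hA; rewrite defA !set_inE negb_or.
    case/andP=> xh yh; have [xD|xD] := boolP (x \in D).
      have yD : y \in D by apply: cl xy xD _; rewrite !set_inE eq_sym.
      by rewrite (setIidPl _) ?cards2 ?(edge_neq xy) // subUset !sub1set xD.
    rewrite (_ : _ :&: D = set0) ?cards0 //; apply/setP=> z; rewrite !set_inE.
    case: eqP => [->|_] /=; first exact: negPf.
    case: eqP => // ->; apply: contraNF xD => yD.
    by apply: cl yD _; rewrite 1?e_sym // !set_inE eq_sym.
  congr (odd _); apply: eq_card => w; rewrite in_set !set_inE [in RHS]in_set.
  by rewrite oddb.
rewrite odd_sum_card => <-; rewrite -[#|D|](cardsID evens) oddD -addbA.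
have -> : [set w in D | odd (degree E w)] = D :\: evens.
  by apply/setP=> w; rewrite !in_set negbK andbC.
by rewrite addbb addbF.
Qed.

Lemma odd_evens : odd #|T| -> odd #|evens|.
Proof.
move=> oddT; have := handshake edges_simple.
have -> : [set w | odd (degree E w)] = ~: evens.
  by apply/setP=> w; rewrite !in_set negbK.
by move: oddT; rewrite -(cardsC evens) oddD => + /negPf evC; rewrite evC addbF.
Qed.

(** * Even order, and an even vertex that separates the others evenly *)
Hypothesis e_conn : connected e.

Lemma closed_full D z :
  (forall x y, e x y -> x \in D -> y \in D) -> z \in D -> forall w, w \in D.
Proof.
move=> clD zD w; rewrite -(closed_connect _ (e_conn z w)) //.
by apply: intro_closed => [|x y]; [apply: sym_connect_sym | apply: clD].
Qed.

Lemma minovl_even_order : ~~ odd #|T| -> minovl e <= 2.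
Proof.
move=> evT.
have [F [sF oddJ acF _]] : exists F : {set {set T}}, [/\ F \subset avoid set0,
    forall w, odd (degree (avoid set0 :\: F) w) = (w \in [set: T]), acyclic F
    & forall A, A \in avoid set0 -> A \notin F -> acyclic (A |: F)].
  apply: join_forest_complement => [|D /separatedP[_ clD]].
    by rewrite disjoints_subset setC0.
  rewrite setIT; have [-> | [z zD]] := set_0Vmem D; first by rewrite cards0.
  rewrite (_ : D = [set: T]) ?cardsT //; apply/setP=> w; rewrite in_setT.
  by apply: closed_full zD w => x y xy xD; apply: clD xy xD _; rewrite in_set0.
have avoid0 : avoid set0 = E.
  apply/setP=> A; rewrite mem_avoid disjoints_subset setC0 subsetT.
  exact: andbT.
rewrite avoid0 in sF oddJ.
have [X [sXF oddX oddFX]] := acyclic_two_coloring (sub_simple sF edges_simple) acF.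
apply: (@minovl_le2_classes (E :\: F) X (F :\: X) set0) => //.
- exact: subsetDl.
- exact: subset_trans sF.
- exact: subset_trans (subsetDl F X) sF.
- by apply/forallP=> w; rewrite oddJ in_setT orbT.
move=> A EA; rewrite !set_inE EA; have := subsetP sXF A.
by case: (A \in X) => [/(_ isT)-> | _] //=; case: (A \in F).
Qed.

(** If h fails because of D, choose an even vertex h' in D. A part D' that
    makes h' fail can be taken without h, because its complement fails as well;
    then D' lies inside D and misses h', so the failure cannot go on for ever. *)
Lemma balanced_even_vertex : odd #|T| ->
  exists2 h, h \in evens & forall D, separated [set h] D -> ~~ odd #|D :&: evens|.
Proof.
move=> oddT.
have rec n h D : #|D| <= n -> separated [set h] D -> odd #|D :&: evens| ->
    exists2 h, h \in evens & forall D, separated [set h] D -> ~~ odd #|D :&: evens|.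
  elim: n h D => [|n IHn] h D leDn sepD oddD0.
    move: oddD0 leDn; case: (set_0Vmem D) => [->|[z zD]];
      rewrite ?set0I ?cards0 // leqn0 cards_eq0 => _ /eqP D0.
    by rewrite D0 in_set0 in zD.
  have [h' /setIP[h'D h'ev]] : exists h', h' \in D :&: evens.
    by apply/set0Pn; apply: contraTneq oddD0 => ->; rewrite cards0.
  have [/exists_inP[D1 sepD1 oddD1] | /exists_inPn good] :=
    boolP [exists D1 in separated [set h'], odd #|D1 :&: evens|]; last first.
    by exists h' => // D1 /good.
  have [D' [sepD' oddD' hD']] : exists D',
      [/\ separated [set h'] D', odd #|D' :&: evens| & h \notin D'].
    have [hD1|] := boolP (h \in D1); last by exists D1.
    exists (~: ([set h'] :|: D1)); split; first exact: separated_compl.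
      have [dis1 _] := separatedP _ _ sepD1.
      have := odd_evens oddT; rewrite -(cardsID D1 evens) setIC oddD oddD1 /=.
      rewrite (cardsD1 h') in_setD h'ev andbT (contraL (dis1 h')) ?set11 //= negbK.
      rewrite add0n; suff -> : ~: (h' |: D1) :&: evens = evens :\: D1 :\ h' by [].
      by apply/setP=> w; rewrite !set_inE negb_or andbA.
    by rewrite !set_inE negbK hD1 orbT.
  have [dis cl] := separatedP _ _ sepD; have [dis' cl'] := separatedP _ _ sepD'.
  apply: (IHn h' D') => //; rewrite -ltnS; apply: leq_trans leDn.
  apply: proper_card; apply/properP; split; last first.
    by exists h' => //; apply/negP=> /dis'; rewrite set11.
  (* D' :\: D is closed under adjacency, hence empty, as it misses h. *)
  apply/subsetP=> z zD'; apply: contraNT (hD') => zD.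
  suff : h \in D' :\: D by rewrite in_setD => /andP[].
  apply: (closed_full (z := z)) => [x y xy|]; last by rewrite in_setD zD.
  rewrite !in_setD => /andP[xD xD'].
  have yD : y \notin D.
    apply: contra xD => yD; apply: cl yD _; rewrite 1?e_sym // !set_inE.
    by apply: contraNneq (hD') => <-.
  by rewrite yD /=; apply: cl' xy xD' _; rewrite !set_inE; apply: contraNneq yD => ->.
have [h hev] : exists h, h \in evens.
  by apply/set0Pn; apply: contraTneq (odd_evens oddT) => ->; rewrite cards0.
have [/exists_inP[D sepD oddD0] | /exists_inPn good] :=
  boolP [exists D in separated [set h], odd #|D :&: evens|].
  exact: rec (leqnn _) sepD oddD0.
by exists h.
Qed.

(** * An even vertex that leaves a component of odd order *)

(** For X a union of components of G - h, the edges that meet X are those on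
    the side of X, including the edges from h to X. *)
Definition splice X M N :=
  [set A : {set T} | if [disjoint A & X] then A \in N else A \in M].

Lemma separated_meets h X A w : separated [set h] X ->
  A \in E -> w \in A -> w != h -> [disjoint A & X] = (w \notin X).
Proof.
move=> /separatedP[dis cl] EA wA neq_wh; have [x wx ->] := edgeP EA wA.
rewrite disjoints_subset subUset !sub1set !in_setC.
case wX: (w \in X) => //=; apply: contraFN wX => xX.
by apply: cl xX _; rewrite 1?e_sym // in_set1.
Qed.

Lemma degree_splice h X M N w : separated [set h] X -> M \subset E -> N \subset E ->
  w != h -> degree (splice X M N) w = if w \in X then degree M w else degree N w.
Proof.
move=> sepX sME sNE neq_wh; have -> : (if w \in X then degree M w else degree N w) =
    degree (if w \in X then M else N) w by case: ifP.
apply: eq_card => A; rewrite !in_set; case wA: (w \in A); rewrite ?andbF // !andbT.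
have [EA|EA] := boolP (A \in E).
  by rewrite (separated_meets sepX EA wA neq_wh); case: (w \in X).
have nM : A \notin M by apply: contra EA; apply: (subsetP sME).
have nN : A \notin N by apply: contra EA; apply: (subsetP sNE).
by case: (w \in X); rewrite (negPf nM) (negPf nN) if_same.
Qed.

Lemma degree_splice_cut h X M N : h \notin X -> M \subset E -> 
    (forall A, A \in E -> h \in A -> A \in M) -> (forall A, A \in N -> h \notin A) ->
  degree (splice X M N) h = #|nbrs h :&: X| /\
  degree (splice X N M) h = #|nbrs h :\: X|.
Proof.
move=> hX sME Mh Nh.
have meets w : [disjoint [set h; w] & X] = (w \notin X).
  by rewrite disjoints_subset subUset !sub1set !in_setC hX.
have inM A : h \in A -> (A \in M) = (A \in E).
  by move=> hA; apply/idP/idP=> [/(subsetP sME) | /Mh->].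
have inN A : h \in A -> (A \in N) = false.
  by move=> hA; apply: contraTF hA; apply: Nh.
split.
  transitivity #|[set A in E | (h \in A) && ~~ [disjoint A & X]]|.
    apply: eq_card => A; rewrite in_set [A \in splice _ _ _]in_set [RHS]in_set.
    case hA: (h \in A); rewrite ?andbF //=.
    by case: ifP => _; rewrite ?inN ?inM ?andbF ?andbT.
  rewrite card_star; apply: eq_card => w; rewrite !in_set meets negbK.
  by rewrite andbC.
transitivity #|[set A in E | (h \in A) && [disjoint A & X]]|.
  apply: eq_card => A; rewrite in_set [A \in splice _ _ _]in_set [RHS]in_set.
  case hA: (h \in A); rewrite ?andbF //=.
  by case: ifP => _; rewrite ?inN ?inM ?andbF ?andbT.
by rewrite card_star; apply: eq_card => w; rewrite !in_set meets andbC.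
Qed.

(** J is chosen even at the neighbours of h and odd elsewhere in G - h, so that
    adding all edges at h makes all degrees other than that of h odd. Since h
    has even degree and an odd number of edges to X, it has an odd number of
    edges on either side, and these two bundles get different colors. *)
Lemma minovl_odd_separation h (X : {set T}) : h \in evens ->
    (forall D, separated [set h] D -> ~~ odd #|D :&: evens|) ->
  separated [set h] X -> odd #|X| -> minovl e <= 2.
Proof.
move=> evh good sepX oddX; have [disX _] := separatedP _ _ sepX.
have hX : h \notin X by apply/negP=> /disX; rewrite set11.
pose U := ~: (h |: nbrs h).
have par D : separated [set h] D -> odd #|D| = odd #|D :&: nbrs h|.
  by move=> sepD; have := good D sepD; rewrite (separated_parity sepD); do 2!case: (odd _).
have [F [sF oddJ acF _]] : exists F : {set {set T}}, [/\ F \subset avoid [set h],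
    forall w, odd (degree (avoid [set h] :\: F) w) = (w \in U), acyclic F
    & forall A, A \in avoid [set h] -> A \notin F -> acyclic (A |: F)].
  apply: join_forest_complement => [|D sepD].
    by rewrite disjoint_sym disjoints1 in_setC negbK setU11.
  have [disD _] := separatedP _ _ sepD.
  have := par D sepD; rewrite -(cardsID (nbrs h) D) oddD.
  have -> : D :\: nbrs h = D :&: U.
    apply/setP=> w; rewrite in_setD in_setI /U in_setC in_setU1 negb_or.
    case wD: (w \in D); rewrite ?andbF //= andbT; have := disD w wD.
    by rewrite in_set1 => ->.
  by case: (odd _); case: (odd _).
pose M := E :\: F; have sFE := subset_trans sF (avoid_sub [set h]).
have oddM w : w != h -> odd (degree M w).
  move=> neq_wh; have := degree_avoid1 neq_wh.
  rewrite (degreeD w sFE) (degreeD w sF).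
  rewrite addnCA => /addnI->; rewrite oddD oddJ /U in_setC in_setU1 (negPf neq_wh) oddb /=.
  by rewrite in_set; case: (e h w).
have sME : M \subset E by exact: subsetDl.
have [Y [sYF oddY oddFY]] := acyclic_two_coloring (sub_simple sFE edges_simple) acF.
have sYE := subset_trans sYF sFE.
have Fh A : A \in F -> h \notin A.
  by move/(subsetP sF); rewrite mem_avoid1 => /andP[].
have [deg1 deg2] : degree (splice X M Y) h = #|nbrs h :&: X| /\
    degree (splice X Y M) h = #|nbrs h :\: X|.
  apply: degree_splice_cut => // A; last by move/(subsetP sYF)/Fh.
  by move=> EA; rewrite in_setD EA andbT; apply: contraL; apply: Fh.
have odd1 : odd #|nbrs h :&: X| by rewrite setIC -par.
have odd2 : odd #|nbrs h :\: X|.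
  move: evh; rewrite in_set degree_nbrs -(cardsID X) oddD odd1.
  by rewrite negbK.
have sSE (M' N' : {set {set T}}) : M' \subset E -> N' \subset E -> splice X M' N' \subset E.
  by move=> /subsetP sM /subsetP sN; apply/subsetP=> A; rewrite in_set; case: ifP => _; auto.
apply: (@minovl_le2_classes (splice X M Y) (splice X Y M) (F :\: Y) set0).
- exact: sSE.
- exact: sSE.
- exact: subset_trans (subsetDl F Y) sFE.
- apply/forallP=> w; case: (eqVneq w h) => [-> | neq_wh]; first by rewrite deg1 odd1 orbT.
  rewrite (degree_splice sepX) //; case: ifP => _; last exact: (forallP oddY).
  by rewrite oddM ?orbT.
- apply/forallP=> w; case: (eqVneq w h) => [-> | neq_wh]; first by rewrite deg2 odd2 orbT.
  rewrite (degree_splice sepX) //; case: ifP => _; first exact: (forallP oddY).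
  by rewrite oddM ?orbT.
- exact: oddFY.
move=> A EA; rewrite ![A \in splice _ _ _]in_set !in_setD EA; have := subsetP sYF A.
by case: ifP => _; case: (A \in Y) => [/(_ isT)-> | _] //=; case: (A \in F).
Qed.

(** * An even vertex that leaves only components of even order *)
Section MissingEvenVertex.
Variable v : T.
Hypothesis ev_v : ~~ odd (degree E v).
Local Notation H := (avoid [set v]).

(** Since F is acyclic, an obstruction P contains all edges at v and is
    determined by that. If A is an edge of J such that F with A is acyclic,
    then the obstruction for K with A added is again P, and it does not contain
    A. An end of A on P of odd degree in K would now have even degree, with A
    but not all of its edges in P; and if exactly one end of A were on P, the
    number of vertices of even degree on P would change by one. In either case
    K with A added splits, and A is the only edge with two colors. *)
Lemma minovl_le2_or_obstruction F :
    F \subset H -> acyclic F -> (forall w, w != v -> odd (degree (H :\: F) w)) ->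
  let K := E :\: (H :\: F) in
  minovl e <= 2 \/
  exists P, [/\ P \subset K, even_graph P, 0 < degree P v,
    forall w, ~~ odd (degree K w) -> 0 < degree P w -> degree P w = degree K w
    & forall x y, [set x; y] \in H -> [set x; y] \notin F ->
        acyclic ([set x; y] |: F) -> 0 < degree P x ->
      ~~ odd (degree K x) /\ 0 < degree P y].
Proof.
move=> sFH acF oddJ K; pose J := H :\: F.
have sHE : H \subset E := avoid_sub [set v].
have sJE : J \subset E := subset_trans (subsetDl H F) sHE.
have sKE : K \subset E := subsetDl E J.
have oddgJ : odd_graph J.
  apply/forallP=> w; have [-> | neq_wv] := eqVneq w v; last by rewrite oddJ ?orbT.
  apply/orP; left; rewrite -leqn0 -(degree_avoid (set11 v)).
  exact: degree_sub (subsetDl H F).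
have degKv : degree K v = degree E v.
  apply: eq_card => A; rewrite in_set [RHS]in_set !in_setD mem_avoid1.
  by case vA: (v \in A); rewrite ?andbF.
have memJ A : A \in E -> (A \in J) = (A \notin K).
  by move=> EA; rewrite [A \in K]in_setD EA andbT negbK.
have memF A : A \in K -> v \notin A -> A \in F.
  move=> KA vA; move: KA; rewrite in_setD in_setD mem_avoid1 vA andbT.
  by case/andP=> + EA; rewrite EA andbT negbK.
have nonempty (Q : {set {set T}}) (p : pred T) :
    odd #|[set w | p w && (0 < degree Q w)]| -> Q != set0.
  move=> oddQ; have /set0Pn[w] : [set w | p w && (0 < degree Q w)] != set0.
    by apply: contraTneq oddQ => ->; rewrite cards0.
  rewrite in_set => /andP[_ /degree_gt0P[A QA _]].
  by apply/set0Pn; exists A.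
have [|gt2] := boolP (minovl e <= 2); [by left | right].
have [[X [sXK oddX oddKX]] | [P [sPK evP fullP oddP]]] :=
  two_coloring (sub_simple sKE edges_simple).
  case/negP: gt2; apply: (@minovl_le2_classes J X (K :\: X) set0) => //.
  - exact: subset_trans sKE.
  - exact: subset_trans (subsetDl K X) sKE.
  move=> A EA; rewrite memJ // [A \in _ :\: X]in_setD; have := subsetP sXK A.
  by case: (A \in X) => [/(_ isT)-> | _] //=; case: (A \in K).
have Pv : 0 < degree P v.
  have := nonempty P _ oddP; apply: contraR; rewrite -leqNgt leqn0 => /eqP Pv0.
  apply/eqP; apply: acF evP; apply/subsetP=> A PA; apply: memF.
    exact: (subsetP sPK).
  by apply: contra_eqN Pv0 => vA; rewrite -lt0n; apply/degree_gt0P; exists A.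
exists P; split=> // x y HA FA acA Px; set A := [set x; y] in HA FA acA.
have [EA vA] : A \in E /\ v \notin A by apply/andP; rewrite -mem_avoid1.
have JA : A \in J by rewrite in_setD FA.
have KA : A \notin K by rewrite -memJ.
have sKAE : A |: K \subset E by rewrite subUset sub1set EA.
have [[X [sXK oddX oddKX]] | [Z [sZK evZ fullZ oddZ]]] :=
  two_coloring (sub_simple sKAE edges_simple).
  case/negP: gt2; apply: (@minovl_le2_classes J X ((A |: K) :\: X) A) => //.
  - exact: subset_trans sKAE.
  - exact: subset_trans (subsetDl _ X) sKAE.
  move=> B EB; rewrite memJ // [B \in _ :\: X]in_setD in_setU1; have := subsetP sXK B.
  rewrite in_setU1; case: (eqVneq B A) => [-> | _] /=.
    by rewrite KA; case: (A \in X).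
  by case: (B \in X) => [/(_ isT)-> | _] //=; case: (B \in K).
have memFA B : B \in A |: K -> v \notin B -> B \in A |: F.
  by rewrite !in_setU1; case: (B == A) => //=; apply: memF.
have degKA w : degree (A |: K) w = (w \in A) + degree K w by rewrite degreeU1.
have degKAv : degree (A |: K) v = degree K v by rewrite degKA (negPf vA).
have Zv : 0 < degree Z v.
  have := nonempty Z _ oddZ; apply: contraR; rewrite -leqNgt leqn0 => /eqP Zv0.
  apply/eqP; apply: acA evZ; apply/subsetP=> B ZB; apply: memFA.
    exact: (subsetP sZK).
  by apply: contra_eqN Zv0 => vB; rewrite -lt0n; apply/degree_gt0P; exists B.
have PKv : degree P v = degree K v by rewrite fullP // degKv.
have ZKv : degree Z v = degree (A |: K) v by rewrite fullZ // degKAv degKv.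
(* P and Z both contain all edges at v, so their difference lies in F with A. *)
have eqPZ : symdiff P Z = set0.
  apply: acA => [|w]; last by rewrite odd_degree_symdiff (negPf (evP w)) (negPf (evZ w)).
  apply/subsetP=> B; rewrite in_set => PZB.
  have KB : B \in A |: K.
    move: PZB; case PB: (B \in P) => /= ZB; last exact: (subsetP sZK).
    by rewrite in_setU1 (subsetP sPK) ?orbT.
  apply: memFA => //; apply/negP=> vB; move: PZB.
  rewrite (degree_eq_mem sZK ZKv KB vB) (degree_eq_mem sPK PKv _ vB) //.
  by move: KB; rewrite in_setU1; case: eqP => // eqBA; rewrite eqBA (negPf vA) in vB.
have {eqPZ} eqPZ : Z = P.
  apply/setP=> B; have /setP/(_ B) := eqPZ; rewrite in_set in_set0.
  by case: (B \in P); case: (B \in Z).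
rewrite {}eqPZ {ZKv Zv} in sZK evZ fullZ oddZ.
have evK w : w \in A -> 0 < degree P w -> ~~ odd (degree K w).
  move=> wA Pw; apply: contra KA => oddK; apply: (subsetP sPK).
  apply: (degree_eq_mem sZK _ (setU11 A K) wA); apply: fullZ => //.
  by rewrite degKA wA /= oddK.
have xA : x \in A := set21 x y; split; first exact: evK.
apply: contraLR oddP; rewrite -eqn0Ngt => /eqP Py0.
rewrite (cardsD1 x) in_set Px evK //= negbK.
move: oddZ; congr (odd _); apply: eq_card => w; rewrite in_set in_setD1 in_set.
rewrite degKA /A in_set2; case: (eqVneq w x) => [-> | _] /=.
  by rewrite -[~~ _]negbK evK ?Px.
by case: eqVneq => [-> | _] //=; rewrite Py0 !andbF.
Qed.

(** With F minimal, every edge of J can play the part of A. Each vertex of P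
    other than v has an edge in J, hence has even degree in K and all its edges
    lead to vertices of P. So P reaches all vertices, and each one but v has
    odd degree in J and even degree in K. *)
Lemma minovl_le2_or_others_odd :
    (forall D, separated [set v] D -> ~~ odd #|D|) ->
  minovl e <= 2 \/ 0 < degree E v /\ (forall w, w != v -> odd (degree E w)).
Proof.
move=> evD.
have [F [sF oddJ acF acAF]] : exists F : {set {set T}}, [/\ F \subset H,
    forall w, odd (degree (H :\: F) w) = (w \in ~: [set v]), acyclic F
    & forall A, A \in H -> A \notin F -> acyclic (A |: F)].
  apply: join_forest_complement => [|D sepD]; first by rewrite disjoints_subset.
  have [dis _] := separatedP _ _ sepD.
  rewrite (setIidPl _) ?evD //; apply/subsetP=> w /dis.
  by rewrite in_setC.
have {}oddJ w : w != v -> odd (degree (H :\: F) w) by rewrite oddJ in_setC in_set1.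
have [|[P [sPK evP Pv fullP spreadP]]] := minovl_le2_or_obstruction sF acF oddJ.
  by left.
right; set K := E :\: (H :\: F) in sPK fullP spreadP.
have sKE : K \subset E := subsetDl _ _.
have sJE : H :\: F \subset E := subset_trans (subsetDl H F) (avoid_sub [set v]).
split; first by apply: leq_trans Pv _; apply: degree_sub (subset_trans sPK sKE).
have evK w : w != v -> 0 < degree P w -> ~~ odd (degree K w).
  move=> neq_wv Pw; have [A] := degree_gt0P _ _ (odd_gt0 (oddJ w neq_wv)).
  rewrite in_setD => /andP[FA HA] wA.
  have [u wu defA] := edgeP (subsetP (avoid_sub _) _ HA) wA.
  by rewrite defA in FA HA; have [] := spreadP w u HA FA (acAF _ HA FA) Pw.
have touched : forall w, w \in [set w | 0 < degree P w].
  apply: (closed_full (z := v)) => [x y xy|]; rewrite !in_set // => Px.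
  have [-> // | neq_yv] := eqVneq y v.
  have EA : [set x; y] \in E by rewrite mem_edge.
  have fromP : [set x; y] \in P -> 0 < degree P y.
    by move=> PA; apply/degree_gt0P; exists [set x; y]; rewrite ?set22.
  have [eq_xv | neq_xv] := eqVneq x v.
    apply: fromP; apply: (degree_eq_mem sPK (fullP x _ Px) _ (set21 x y)).
      rewrite eq_xv; have := ev_v; rewrite (degreeD v sJE) oddD.
      rewrite -/K (_ : degree (H :\: F) v = 0) //; apply/eqP; rewrite -leqn0.
      rewrite -(degree_avoid (set11 v)).
      exact: degree_sub (subsetDl H F).
    by rewrite in_setD EA in_setD mem_avoid1 eq_xv set21 !andbF.
  have HA : [set x; y] \in H.
    by rewrite mem_avoid1 EA in_set2 negb_or eq_sym neq_xv eq_sym.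
  have [FA | FA] := boolP ([set x; y] \in F); last first.
    by have [] := spreadP x y HA FA (acAF _ HA FA) Px.
  apply: fromP; apply: (degree_eq_mem sPK (fullP x (evK x neq_xv Px) Px) _ (set21 x y)).
  by rewrite in_setD EA in_setD FA.
move=> w neq_wv; rewrite (degreeD w sJE) oddD oddJ //.
by rewrite (negPf (evK w neq_wv _)) //; have := touched w; rewrite in_set.
Qed.

Hypothesis oddE : forall w, w != v -> odd (degree E w).

(** All degrees in K are even, so that K itself is the only possible
    obstruction, and K misses x. As G is connected, some edge leads from a
    vertex of K to a vertex z outside K. It belongs to J; F with this edge
    added is acyclic since F does not meet z. So the edge can be doubled. *)
Lemma minovl_spared_vertex x : x != v -> ~~ e v x ->
    (forall D, separated [set v; x] D -> ~~ odd #|D :&: nbrs v|) ->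
  minovl e <= 2.
Proof.
move=> neq_xv nvx evD.
have disN : [disjoint nbrs v & [set v; x]].
  by rewrite disjoint_sym disjoints_subset subUset !sub1set !in_setC !in_set e_irr.
have [F0 sF0 parF0] := separated_join disN evD.
have [F [sF parF acF _]] := minimal_join (@avoid_simple _) sF0.
have sFH : F \subset H.
  apply/subsetP=> A /(subsetP sF); rewrite mem_avoid1 mem_avoid => /andP[-> dis].
  by apply/negP=> vA; have := disjointFr dis vA; rewrite set21.
have oddJ w : w != v -> odd (degree (H :\: F) w).
  move=> neq_wv; have := oddE neq_wv; rewrite (degree_avoid1 neq_wv).
  rewrite (degreeD w sFH) !oddD parF parF0 in_set oddb.
  by rewrite addbA addbb.
have [// | [P [sPK evP Pv fullP spreadP]]] := minovl_le2_or_obstruction sFH acF oddJ.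
set K := E :\: (H :\: F) in sPK fullP spreadP.
have sJE : H :\: F \subset E := subset_trans (subsetDl H F) (avoid_sub [set v]).
have evK : even_graph K.
  move=> w; have [-> | neq_wv] := eqVneq w v; last first.
    by have := oddE neq_wv; rewrite (degreeD w sJE) oddD oddJ.
  have := ev_v; rewrite (degreeD v sJE) oddD -/K.
  rewrite (_ : degree (H :\: F) v = 0) //; apply/eqP; rewrite -leqn0.
  by rewrite -(degree_avoid (set11 v)); apply: degree_sub (subsetDl H F).
have sKP : K \subset P.
  rewrite -setD_eq0; apply/eqP; apply: acF => [|w]; last first.
    by have := evK w; rewrite (degreeD w sPK) oddD (negPf (evP w)).
  apply/subsetP=> A; rewrite in_setD => /andP[PA KA].
  have vA : v \notin A.
    apply: contra PA => vA.
    exact: degree_eq_mem sPK (fullP v (evK v) Pv) KA vA.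
  move: KA; rewrite in_setD in_setD mem_avoid1 vA andbT.
  by case/andP=> + EA; rewrite EA andbT negbK.
have sFK : F \subset K.
  apply/subsetP=> A FA; rewrite in_setD in_setD FA /=.
  exact: (subsetP (avoid_sub _)) (subsetP sFH _ FA).
have touched : forall w, w \in [set w | 0 < degree P w].
  apply: (closed_full (z := v)) => [a b ab|]; rewrite !in_set // => Pa.
  have EA : [set a; b] \in E by rewrite mem_edge.
  have [KA | KA] := boolP ([set a; b] \in K).
    by apply/degree_gt0P; exists [set a; b]; rewrite ?set22 ?(subsetP sKP).
  move: KA; rewrite in_setD EA andbT negbK in_setD => /andP[FA HA].
  rewrite lt0n; apply/negP=> /eqP Pb0.
  suff acA : acyclic ([set a; b] |: F).
    by have [_] := spreadP a b HA FA acA Pa; rewrite Pb0.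
  move=> Z sZ evZ; have [ZA | ZA] := boolP ([set a; b] \in Z).
    have [B [ZB bB neqB]] := even_graph_next evZ ZA (set22 a b).
    have FB : B \in F by have := subsetP sZ B ZB; rewrite in_setU1 (negPf neqB).
    suff : 0 < degree P b by rewrite Pb0.
    by apply/degree_gt0P; exists B => //; apply/(subsetP sKP)/(subsetP sFK).
  apply: acF => //; apply/subsetP=> B ZB; have := subsetP sZ B ZB.
  by rewrite in_setU1; case: eqP => // eqB; rewrite -eqB ZB in ZA.
have := touched x; rewrite in_set => /degree_gt0P[A PA xA].
have := subsetP sPK A PA; rewrite in_setD => /andP[JA EA].
have vA : v \notin A.
  have [u xu ->] := edgeP EA xA; rewrite in_set2 negb_or eq_sym neq_xv /=.
  by apply: contraNneq nvx => ->; rewrite e_sym.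
have FA : A \in F by move: JA; rewrite in_setD mem_avoid1 EA vA /= andbT negbK.
have := subsetP sF A FA; rewrite mem_avoid => /andP[_ dis].
by have := disjointFr dis xA; rewrite set22.
Qed.

(** Color the star of u with 2, the edges of F with 3, the edge uv with both
    and the rest with 1. A neighbour of u other than v loses two edges to the
    colors 2 and 3, the vertices outside u and its neighbours none, so color 1
    is odd there; it does not occur at u, and at v all three colors are odd. *)
Lemma minovl_two_stars u F : e v u -> F \subset avoid [set u] ->
  (forall w, w != v -> degree F w = e u w) -> minovl e <= 2.
Proof.
move=> vu sF degF; have neq_uv : u != v by rewrite eq_sym edge_neq.
have sFE := subset_trans sF (avoid_sub [set u]).
have uv : e u v by rewrite e_sym.
have ev_Fv : ~~ odd (degree F v).
  have := handshake (sub_simple sFE edges_simple); apply: contra => oddFv.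
  suff -> : [set w | odd (degree F w)] = nbrs u by rewrite -degree_nbrs oddE.
  apply/setP=> w; rewrite !in_set; case: (eqVneq w v) => [-> | neq_wv].
    by rewrite oddFv uv.
  by rewrite degF // oddb.
set S := E :\: avoid [set u]; set J := avoid [set u] :\: F.
set A0 := [set u; v]; have EA0 : A0 \in E by rewrite mem_edge.
have FA0 : A0 \notin F.
  by apply/negP=> /(subsetP sF); rewrite mem_avoid1 set21 andbF.
have degJ w : w != u -> degree E w = e u w + (degree F w + degree J w).
  by move=> neq_wu; rewrite (degree_avoid1 neq_wu) (degreeD w sF).
apply: (@minovl_le2_classes J S (A0 |: F) A0).
- exact: subset_trans (subsetDl _ F) (avoid_sub _).
- exact: subsetDl.
- by rewrite subUset sub1set EA0.
- apply/forallP=> w; have [-> | neq_wu] := eqVneq w u.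
    apply/orP; left; rewrite -leqn0 -(degree_avoid (set11 u)).
    exact: degree_sub (subsetDl _ F).
  have := degJ w neq_wu; have [-> | neq_wv] := eqVneq w v.
    move: ev_v => + /(congr1 odd); rewrite uv !oddD (negPf ev_Fv) => /negPf->.
    by case: (odd (degree J v)); rewrite ?orbT.
  rewrite degF // => /(congr1 odd); rewrite oddE // !oddD addbA addbb addFb => <-.
  by rewrite orbT.
- apply/forallP=> w; rewrite degree_star; case: (eqVneq w u) => _; last by case: (e u w).
  by rewrite oddE ?orbT.
- apply/forallP=> w; rewrite degreeU1 // in_set2.
  have [-> | neq_wv] := eqVneq w v; first by rewrite orbT addSn /= ev_Fv.
  by rewrite degF //; case: (eqVneq w u) => [-> | _]; rewrite ?e_irr //; case: (e u w).
move=> A EA; rewrite in_setU1 !in_setD EA andbT; have := subsetP sF A.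
have [-> _ | _] := eqVneq A A0; last first.
  by case: (A \in F) => [/(_ isT)-> | _] //=; case: (A \in avoid [set u]).
by rewrite mem_avoid1 set21 !andbF.
Qed.

Definition spokes W : {set {set T}} := [set [set v; w] | w in W].

Lemma mem_spokes W A : A \in spokes W -> exists2 w, w \in W & A = [set v; w].
Proof. by move/imsetP. Qed.

Lemma degree_spokes W w : v \notin W -> w != v -> degree (spokes W) w = (w \in W).
Proof.
move=> vW neq_wv; case wW: (w \in W).
  rewrite -[RHS](cards1 [set v; w]); apply: eq_card => A; rewrite in_set in_set1.
  apply/andP/eqP=> [[/mem_spokes[x _ ->]] | ->]; last first.
    by rewrite set22; split=> //; apply/imsetP; exists w.
  by rewrite in_set2 (negPf neq_wv) => /eqP->.
apply/eqP; rewrite -leqn0 leqNgt; apply/degree_gt0P=> -[A /mem_spokes[x xW ->]].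
by rewrite in_set2 (negPf neq_wv) => /eqP eq_wx; rewrite eq_wx xW in wW.
Qed.

Lemma spokes_avoid u W : u != v -> u \notin W -> (forall w, w \in W -> e v w) ->
  spokes W \subset avoid [set u].
Proof.
move=> neq_uv uW vW; apply/subsetP=> A /mem_spokes[w wW ->].
rewrite mem_avoid1 mem_edge vW // in_set2 negb_or neq_uv /=.
by apply: contraNneq uW => ->.
Qed.

(** The star from v to the other neighbours of u serves as F. *)
Lemma minovl_nbrs_included u : e v u ->
  (forall w, e u w -> w != v -> e v w) -> minovl e <= 2.
Proof.
move=> vu incl; have neq_uv : u != v by rewrite eq_sym edge_neq.
apply: (@minovl_two_stars u (spokes (nbrs u :\ v))) => // [|w neq_wv].
  apply: spokes_avoid => // [|w]; first by rewrite in_setD1 in_set e_irr andbF.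
  by rewrite in_setD1 in_set => /andP[neq_wv uw]; apply: incl.
by rewrite degree_spokes ?setD11 // in_setD1 neq_wv in_set.
Qed.

(** As c need not be adjacent to v, the edge qc takes the place of vc and vq. *)
Lemma minovl_nbrs_included_but_one u c q :
    e v u -> e u c -> c != v -> e u q -> e v q -> e q c ->
    (forall w, e u w -> w != v -> w != c -> e v w) ->
  minovl e <= 2.
Proof.
move=> vu uc neq_cv uq vq qc incl; have neq_uv : u != v by rewrite eq_sym edge_neq.
have neq_qv : q != v by rewrite eq_sym edge_neq.
pose W := nbrs u :\: [set v; c; q].
have memW w : (w \in W) = [&& w != v, w != c, w != q & e u w].
  by rewrite in_setD !set_inE [w \in nbrs u]in_set !negb_or -!andbA.
have vW : v \notin W by rewrite memW eqxx.
have FW : [set q; c] \notin spokes W.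
  apply/negP=> /mem_spokes[w _ defA]; have := set21 v w.
  by rewrite -defA in_set2 eq_sym (negPf neq_qv) eq_sym (negPf neq_cv).
apply: (@minovl_two_stars u ([set q; c] |: spokes W)) => // [|w neq_wv].
  rewrite subUset sub1set mem_avoid1 mem_edge qc in_set2 negb_or !edge_neq //=.
  apply: spokes_avoid => // [|w]; first by rewrite memW e_irr !andbF.
  by rewrite memW => /and4P[neq_wv neq_wc _ uw]; apply: incl.
rewrite degreeU1 // degree_spokes // memW neq_wv in_set2 /=.
case: (eqVneq w q) => [-> | neq_wq] /=; first by rewrite uq andbF.
by case: (eqVneq w c) => [-> | neq_wc] /=; rewrite ?uc.
Qed.

Hypothesis evD : forall D, separated [set v] D -> ~~ odd #|D|.

(** If C contains a vertex x that is not adjacent to v and x cannot be spared,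
    then some union D of components of G - v - x has an odd number of
    neighbours of v. So does its complement, and one of the two misses c. It
    meets C, for otherwise it would be a union of components of G - v; then
    C :&: D is a smaller set cut off by v and x. Once C consists of neighbours of
    v, the neighbours of a vertex u of C are neighbours of v, apart from v and
    c. If c is adjacent to all of C, the odd degree of u gives it a third
    neighbour q, which is adjacent to c. *)
Lemma minovl_cut_pair n C c z :
    #|C| <= n -> z \in C -> separated [set v; c] C -> c != v -> ~~ e v c ->
  minovl e <= 2.
Proof.
elim: n C c z => [|n IHn] C c z leCn zC sepC neq_cv nvc.
  by move: leCn; rewrite leqn0 cards_eq0 => /eqP C0; rewrite C0 in_set0 in zC.
have [disC clC] := separatedP _ _ sepC.
have [/exists_inP[x xC nvx] | /exists_inPn allN] := boolP [exists x in C, ~~ e v x].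
  have := disC x xC; rewrite in_set2 negb_or => /andP[neq_xv neq_xc].
  have [/exists_inP[D1 sepD1 oddD1] | /exists_inPn allD] :=
      boolP [exists D in separated [set v; x], odd #|D :&: nbrs v|]; last first.
    by apply: (minovl_spared_vertex neq_xv nvx) => D /allD.
  have [D [sepD oddD0 cD]] : exists D,
      [/\ separated [set v; x] D, odd #|D :&: nbrs v| & c \notin D].
    have [cD1 | ] := boolP (c \in D1); last by exists D1.
    exists (~: ([set v; x] :|: D1)); split; first exact: separated_compl.
      have := ev_v; rewrite degree_nbrs -(cardsID D1) oddD setIC oddD1 /= negbK.
      suff -> : ~: ([set v; x] :|: D1) :&: nbrs v = nbrs v :\: D1 by [].
      apply/setP=> w; rewrite !set_inE [w \in nbrs v]in_set andbC.
      rewrite [in RHS]andbC !negb_or -!andbA; case vw: (e v w) => //=.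
      rewrite eq_sym (edge_neq vw) /=; case: eqVneq => // eq_wx.
      by rewrite -eq_wx vw in nvx.
    by rewrite in_setC negbK in_setU cD1 orbT.
  have [disD clD] := separatedP _ _ sepD.
  have xD : x \notin D by apply/negP=> /disD; rewrite set22.
  have [y yCD] : exists y, y \in C :&: D.
    apply/set0Pn; apply: contraTneq oddD0 => CD0.
    have sepvD : separated [set v] D.
      apply/separatedP; split=> [a /disD | a b ab aD]; rewrite in_set1.
        by rewrite in_set2 negb_or => /andP[].
      have := disD a aD; rewrite in_set2 negb_or => /andP[neq_av neq_ax] neq_bv.
      apply: clD (ab) (aD) _; rewrite in_set2 negb_or neq_bv /=.
      apply: contraTneq isT => eq_bx.
      have /setP/(_ a) := CD0; rewrite in_setI aD in_set0 andbT => /negbT/negP[].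
      apply: clC (xC) _; first by rewrite e_sym -eq_bx.
      by rewrite in_set2 negb_or neq_av; apply: contraNneq cD => <-.
    have := separated_parity sepvD; rewrite (negPf (evD sepvD)) /= => <-.
    rewrite (_ : D :&: evens = set0) ?cards0 //; apply/setP=> w.
    rewrite !set_inE [w \in evens]in_set; case wD: (w \in D) => //=.
    by rewrite oddE //; have := disD w wD; rewrite in_set2 negb_or => /andP[].
  apply: (IHn (C :&: D) x y) => //.
    rewrite -ltnS; apply: leq_trans leCn; apply: proper_card; apply/properP.
    by split; [apply: subsetIl | exists x; rewrite // in_setI (negPf xD) andbF].
  apply/separatedP; split=> [w /setIP[_ /disD] // | a b ab /setIP[aC aD] nb].
  have bD := clD a b ab aD nb; rewrite in_setI bD andbT; apply: clC ab aC _.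
  move: nb; rewrite !in_set2 !negb_or => /andP[-> _] /=.
  by apply: contraNneq cD => <-.
have {}allN w : w \in C -> e v w by move/allN; rewrite negbK.
have inC u w : u \in C -> e u w -> w != v -> w != c -> w \in C.
  by move=> uC uw neq_wv neq_wc; apply: clC uw uC _; rewrite in_set2 negb_or neq_wv.
have [/exists_inP[u uC nuc] | /exists_inPn all_c] := boolP [exists u in C, ~~ e u c].
  apply: (minovl_nbrs_included (allN u uC)) => w uw neq_wv; apply: allN.
  by apply: (inC u) => //; apply: contraNneq nuc => <-.
have {}all_c w : w \in C -> e w c by move/all_c; rewrite negbK.
have neq_zv : z != v by rewrite eq_sym edge_neq // allN.
have [q] : exists q, q \in nbrs z :\: [set v; c].
  apply/set0Pn; rewrite setD_eq0; apply: contraL (oddE neq_zv) => sub.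
  rewrite degree_nbrs (_ : nbrs z = [set v; c]) ?cards2 1?eq_sym ?neq_cv //.
  apply/eqP; rewrite eqEsubset sub subUset !sub1set !in_set e_sym allN //=.
  exact: all_c.
rewrite in_setD in_set2 negb_or in_set => /andP[/andP[neq_qv neq_qc] zq].
have qC : q \in C by apply: (inC z).
apply: (@minovl_nbrs_included_but_one z c q) => // [||||w zw neq_wv neq_wc].
- exact: allN.
- exact: all_c.
- exact: allN.
- exact: all_c.
by apply: allN; apply: (inC z).
Qed.

Lemma minovl_others_odd : 0 < degree E v -> minovl e <= 2.
Proof.
rewrite degree_nbrs => /card_gt0P[u]; rewrite in_set => vu.
have neq_uv : u != v by rewrite eq_sym edge_neq.
have [/existsP[c /andP[neq_cv nvc]] | /existsPn allN] :=
  boolP [exists c, (c != v) && ~~ e v c].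
  apply: (@minovl_cut_pair _ (~: [set v; c]) c u (leqnn _)) => //.
    rewrite in_setC in_set2 negb_or neq_uv /=.
    by apply: contraNneq nvc => <-.
  by apply/separatedP; split=> [w | x y _ _]; rewrite in_setC.
apply: (minovl_nbrs_included vu) => w _ neq_wv.
by have := allN w; rewrite neq_wv negbK.
Qed.

End MissingEvenVertex.

End Graph.

(** * The bound *)

Theorem theorem1p6 (T : finType) (e : rel T)
    (e_sym : symmetric e) (e_irr : irreflexive e) (e_conn : connected e) :
  minovl e <= 2.
Proof.
have [oddT | evT] := boolP (odd #|T|); last exact: minovl_even_order.
have [v ev_v balanced] := balanced_even_vertex e_sym e_irr e_conn oddT.
have [/exists_inP[X sepX oddX] | /exists_inPn evD] :=
  boolP [exists X in separated e [set v], odd #|X|].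
  exact: minovl_odd_separation ev_v balanced sepX oddX.
move: ev_v; rewrite in_set => ev_v.
have [// | [deg_v oddE]] := minovl_le2_or_others_odd e_sym e_irr e_conn ev_v evD.
exact: minovl_others_odd oddE evD deg_v.
Qed.
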